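(* Let $w$ be a positive even integer and $n$ a positive integer. For any quantum modular form $\widetilde f\in\mathcal{Q}_{-w}$ define $$(T_n^{\infty}\widetilde f)(x)=\sum_{ad=n,\ d>0}d^{w}\sum_{b=0}^{d-1}\widetilde f\left(\frac{ax+b}{d}\right)\qquad(x\in\mathbb{Q}).$$ Then $T_n^{\infty}\widetilde f\in\mathcal{Q}_{-w}$. Moreover $T_n^{\infty}(\mathcal{Q}_{-w}^{p})\subseteq\mathcal{Q}_{-w}^{p}$ and $T_n^{\infty}(\mathcal{Q}_{poly,-w}^{p})\subseteq\mathcal{Q}_{poly,-w}^{p}$.
   Context: A function $\widetilde f:\mathbb{Q}\to\mathbb{C}$ is a quantum modular form of weight $-w$ on $\mathrm{SL}_2(\mathbb{Z})$ (trivial multiplier) if for every $\gamma=\begin{pmatrix}a&b\\c&d\end{pmatrix}\in\mathrm{SL}_2(\mathbb{Z})$ the function $h_\gamma(x)=\widetilde f(x)-(cx+d)^{w}\widetilde f\left(\frac{ax+b}{cx+d}\right)$ (defined for $x\in\mathbb{Q}$, $cx+d\ne0$) can be extended smoothly to $\mathbb{R}$ except at finitely many points, i.e. there is a finite set $S\subset\mathbb{Q}$ and a $C^\infty$ function on $\mathbb{R}\setminus S$ agreeing with $h_\gamma$ on $\mathbb{Q}\setminus S$. $\mathcal{Q}_{-w}$ is the space of such functions. $\mathcal{Q}_{-w}^{p}=\{\widetilde f\in\mathcal{Q}_{-w}:\widetilde f(x+1)=\widetilde f(x)\text{ for all }x\in\mathbb{Q}\}$. $\mathcal{Q}_{poly,-w}^{p}$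 is the space of $\widetilde f\in\mathcal{Q}_{-w}^{p}$ for which there exist $c_0,\dots,c_w\in\mathbb{C}$ with $\widetilde f(x)-x^{w}\widetilde f(-1/x)=\sum_{j=0}^{w}c_jx^{j}$ for all $x\in\mathbb{Q}\setminus\{0\}$. *)

(* Defs.v *)
From mathcomp Require Import all_boot all_order all_algebra.
From mathcomp Require Import all_classical all_reals all_analysis.
From mathcomp Require Export complex.

Set Implicit Arguments.
Unset Strict Implicit.
Unset Printing Implicit Defensive.

Import Order.TTheory GRing.Theory Num.Theory.
Import numFieldNormedType.Exports.

Local Open Scope classical_set_scope.
Local Open Scope ring_scope.

(* The library has no R-normed module structure on R[i], so smoothness is
   stated componentwise. For A open, the values of g outside A are irrelevant,
   since derivatives at points of A are local. *)
Definition smooth_on (R : realType) (A : set R) (g : R -> R[i]) : Prop :=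
  forall (k : nat) (x : R), A x ->
    derivable (derive1n k (fun t : R => complex.Re (g t))) x 1 /\
    derivable (derive1n k (fun t : R => complex.Im (g t))) x 1.

Definition aut_den (g : 'M[int]_2) (x : rat) : rat :=
  (g 1 0)%:~R * x + (g 1 1)%:~R.

Definition moebius (g : 'M[int]_2) (x : rat) : rat :=
  ((g 0 0)%:~R * x + (g 0 1)%:~R) / aut_den g x.

(* Only meaningful where aut_den g x != 0. *)
Definition period_fun (R : realType) (w : nat) (f : rat -> R[i])
    (g : 'M[int]_2) (x : rat) : R[i] :=
  f x - ratr (aut_den g x) ^+ w * f (moebius g x).

Definition extends_smoothly (R : realType) (D : set rat) (h : rat -> R[i]) :
    Prop :=
  exists (S : set rat) (H : R -> R[i]),
    [/\ finite_set S,
        smooth_on (~` [set ratr s | s in S]) H &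
        forall x : rat, D x -> ~ S x -> H (ratr x) = h x].

Definition quantum_modular (R : realType) (w : nat) : set (rat -> R[i]) :=
  [set f | forall g : 'M[int]_2, \det g = 1 ->
     extends_smoothly [set x | aut_den g x != 0] (period_fun w f g)].

Definition quantum_modular_p (R : realType) (w : nat) : set (rat -> R[i]) :=
  [set f | quantum_modular w f /\ forall x : rat, f (x + 1) = f x].

Definition quantum_modular_poly_p (R : realType) (w : nat) :
    set (rat -> R[i]) :=
  [set f | quantum_modular_p w f /\
     exists c : 'I_w.+1 -> R[i], forall x : rat, x != 0 ->
       f x - ratr x ^+ w * f (- 1 / x) = \sum_(j < w.+1) c j * ratr x ^+ j].

Definition hecke_infty (R : realType) (w n : nat) (f : rat -> R[i])
    (x : rat) : R[i] :=
  \sum_(d <- divisors n)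
     d%:R ^+ w * \sum_(b < d) f (((n %/ d)%:R * x + b%:R) / d%:R).

(* Main.v *)
(* Write F (p, q) = q^w f (p / q), a function on Q^2 homogeneous of degree w.
   Then (T_n f)(x) is the sum of F (M (x, 1)) over the matrices
   M = [[a, b], [0, d]] with ad = n and 0 <= b < d. These represent the left
   SL_2(Z)-cosets of integer matrices of determinant n, so for g in SL_2(Z) the
   matrices M g are, up to order, the gamma_M M with gamma_M in SL_2(Z). Hence
   the period of T_n f at g is the sum over M of the function
   F v - F (gamma_M v) at v = M (x, 1), i.e. of the period of f at gamma_M
   evaluated at an affine function of x, times d^w.

   In the polynomial case F extends to the points (p, 0) in such a way that
   F (p, q) - F (-q, p) is a form of degree w on all of Q^2, and the Euclidean
   algorithm, which writes gamma as a word in x + 1 and -1/x, shows that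
   F v - F (gamma v) is one as well, for every gamma. *)
Require Import Defs.
From mathcomp Require Import all_boot all_order all_algebra.
From mathcomp Require Import all_classical all_reals all_analysis.
From mathcomp Require Import zify ring.

Set Implicit Arguments.
Unset Strict Implicit.
Unset Printing Implicit Defensive.

Import Order.TTheory GRing.Theory Num.Theory.
Import numFieldNormedType.Exports.

Local Open Scope classical_set_scope.
Local Open Scope ring_scope.

(** * Smooth real functions: sums and affine substitution *)

Section Smoothness.
Variable R : realType.
Implicit Types (A : set R) (u v : R -> R) (G : R -> R[i]).

Definition smooth_real A u := forall k x, A x -> derivable (derive1n k u) x 1.

(** Differentiating once more needs the identity near [x], not only at [x]; openness of [A] supplies
    it. *)
Lemma derive1n_near_add A u v k x : open A -> smooth_real A u ->
  smooth_real A v -> A x ->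
  derive1n k (u \+ v) x = derive1n k u x + derive1n k v x.
Proof.
move=> oA su sv; elim: k x => [//|k IH] x Ax.
rewrite !derive1nS !derive1E.
rewrite (@near_eq_derive _ _ _ _ (derive1n k u \+ derive1n k v)).
  by rewrite deriveD //; [apply: su|apply: sv].
by apply: filterS (open_nbhs_nbhs (conj oA Ax)) => y /IH.
Qed.

Lemma smooth_real_add A u v : open A -> smooth_real A u -> smooth_real A v ->
  smooth_real A (u \+ v).
Proof.
move=> oA su sv k x Ax.
apply: (@near_eq_derivable _ _ _ (derive1n k u \+ derive1n k v)).
  apply: filterS (open_nbhs_nbhs (conj oA Ax)) => y Ay.
  by rewrite (derive1n_near_add k oA su sv Ay).
by apply: derivableD; [apply: su|apply: sv].
Qed.

Lemma is_derive_affine (a b x : R) : is_derive x 1 (fun t : R => a * t + b) a.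
Proof.
suff: is_derive x 1 ((a \*: (id : R -> R)) + cst b) (a *: 1 + 0).
  by rewrite addr0 [a *: 1]mulr1.
exact: is_deriveD.
Qed.

Lemma smooth_real_is_derive A u k x : smooth_real A u -> A x ->
  is_derive x 1 (derive1n k u) (derive1n k.+1 u x).
Proof.
by move=> su Ax; rewrite derive1nS derive1E; apply: DeriveDef => //; apply: su.
Qed.

Lemma is_derive_derive1n_affine A u (a b : R) k x : smooth_real A u ->
  A (a * x + b) ->
  is_derive x 1 (fun t => a ^+ k * derive1n k u (a * t + b))
                (a ^+ k.+1 * derive1n k.+1 u (a * x + b)).
Proof.
move=> su Ax.
have := @is_derive1_comp _ (derive1n k u) (fun t => a * t + b) x _ _
  (smooth_real_is_derive k su Ax) (is_derive_affine a b x).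
move=> /(is_deriveZ (a ^+ k)).
by rewrite mulrC exprSr [_ *: _]mulrA.
Qed.

Section AffineSubstitution.
Variables (A : set R) (u : R -> R) (a b : R).
Hypotheses (oA : open A) (su : smooth_real A u).

Let oA' : open [set t | A (a * t + b)].
Proof.
apply: open_comp => // t _; apply: differentiable_continuous.
by apply/derivable1_diffP; case: (is_derive_affine a b t).
Qed.

Lemma derive1n_affine k x : A (a * x + b) ->
  derive1n k (fun t => u (a * t + b)) x = a ^+ k * derive1n k u (a * x + b).
Proof.
elim: k x => [|k IH] x Ax; first by rewrite mul1r.
rewrite -[LHS]/(derive1 (derive1n k (fun t => u (a * t + b))) x) derive1E.
rewrite (@near_eq_derive _ _ _ _ (fun t => a ^+ k * derive1n k u (a * t + b))).
  by case: (is_derive_derive1n_affine k su Ax).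
by apply: filterS (open_nbhs_nbhs (conj oA' Ax)) => y /IH.
Qed.

Lemma smooth_real_affine :
  smooth_real [set t | A (a * t + b)] (fun t => u (a * t + b)).
Proof.
move=> k x Ax.
apply: (@near_eq_derivable _ _ _ (fun t => a ^+ k * derive1n k u (a * t + b))).
  apply: filterS (open_nbhs_nbhs (conj oA' Ax)) => y Ay.
  by rewrite derive1n_affine.
by case: (is_derive_derive1n_affine k su Ax).
Qed.

End AffineSubstitution.

Lemma smooth_real0 A : smooth_real A (cst 0).
Proof.
move=> k x _; suff -> : derive1n k (cst 0) = cst 0 :> (R -> R) by [].
elim: k => // k IH; rewrite derive1nS IH.
by apply/funext => y; rewrite derive1_cst.
Qed.

Lemma smooth_onP A G : smooth_on A G <->
  smooth_real A (fun t => complex.Re (G t)) /\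
  smooth_real A (fun t => complex.Im (G t)).
Proof.
by split=> [sG|[? ?]]; [split=> k x /sG-/(_ k)[]|move=> k x Ax; split; auto].
Qed.

End Smoothness.

(** * Smooth extension outside a finite set *)

Section ExtendsSmoothly.
Variable R : realType.
Implicit Types (D E : set rat) (h : rat -> R[i]) (S : set rat).

Lemma open_setC_ratr S : finite_set S -> open (~` [set (ratr s : R) | s in S]).
Proof.
move=> fS; rewrite openC; apply: (accessible_finite_set_closed.1 _ _ _).
  exact/hausdorff_accessible/Rhausdorff.
exact: finite_image.
Qed.

Lemma extends_smoothly_sub D E h h' : E `<=` D -> {in E, h =1 h'} ->
  extends_smoothly D h -> extends_smoothly E h'.
Proof.
move=> ED hh' [S [H [fS sH eH]]]; exists S, H; split=> // x Ex Sx.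
by rewrite eH //; [apply: hh'; rewrite inE|apply: ED].
Qed.

Lemma extends_smoothly0 D : extends_smoothly D (fun=> 0 : R[i]).
Proof.
exists set0, (fun=> 0); split=> //.
by apply/smooth_onP; split; exact: smooth_real0.
Qed.

Lemma extends_smoothly_add D h h' : extends_smoothly D h ->
  extends_smoothly D h' -> extends_smoothly D (fun x => h x + h' x).
Proof.
move=> [S [H [fS sH eH]]] [S' [H' [fS' sH' eH']]].
exists (S `|` S'), (fun t => H t + H' t).
have fSS' : finite_set (S `|` S') by rewrite finite_setU.
have [sre sim] := (smooth_onP _ _).1 sH.
have [sre' sim'] := (smooth_onP _ _).1 sH'.
have oU := open_setC_ratr fSS'.
have subl : ~` [set (ratr s : R) | s in S `|` S'] `<=` ~` [set ratr s | s in S].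
  by apply: subsetC => _ [s Ss <-]; exists s => //; left.
have subr :
    ~` [set (ratr s : R) | s in S `|` S'] `<=` ~` [set ratr s | s in S'].
  by apply: subsetC => _ [s Ss <-]; exists s => //; right.
split=> //.
- apply/smooth_onP; split.
    rewrite [X in smooth_real _ X](_ : _ =
        (fun t => complex.Re (H t)) \+ (fun t => complex.Re (H' t))).
      by apply: smooth_real_add => // k x Ax; [exact/sre/subl|exact/sre'/subr].
    by apply/funext => t; exact: raddfD.
  rewrite [X in smooth_real _ X](_ : _ =
      (fun t => complex.Im (H t)) \+ (fun t => complex.Im (H' t))); last first.
    by apply/funext => t; exact: raddfD.
  by apply: smooth_real_add => // k x Ax; [exact/sim/subl|exact/sim'/subr].
- by move=> x Dx /not_orP[nS nS']; rewrite eH ?eH'.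
Qed.

Lemma extends_smoothly_sum (I : eqType) (s : seq I) D (h : I -> rat -> R[i]) :
  (forall i, i \in s -> extends_smoothly D (h i)) ->
  extends_smoothly D (fun x => \sum_(i <- s) h i x).
Proof.
elim: s => [|i s IH] hs.
  by apply: extends_smoothly_sub (extends_smoothly0 D) => // x _;
    rewrite big_nil.
have hi : extends_smoothly D (h i) by apply: hs; rewrite mem_head.
have {}IH := IH (fun j js => hs j (mem_behead (s := i :: s) js)).
apply: extends_smoothly_sub (extends_smoothly_add hi IH) => // x _.
by rewrite big_cons.
Qed.

(** The new exceptional set is the preimage of the old one under the affine map; with [a != 0] it
    consists of the points [(s - b) / a]. *)
Lemma extends_smoothly_affine D h (a b : rat) : a != 0 ->
  extends_smoothly D h ->
  extends_smoothly [set x | D (a * x + b)] (fun x => h (a * x + b)).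
Proof.
move=> a0 [S [H [fS sH eH]]].
exists [set (s - b) / a | s in S], (fun t => H (ratr a * t + ratr b)); split.
- exact: finite_image.
- have sA : ~` [set (ratr t : R) | t in [set (s - b) / a | s in S]] `<=`
      [set t | (~` [set ratr s | s in S]) (ratr a * t + ratr b)].
    move=> t /= nt [s Ss st]; apply: nt; exists ((s - b) / a).
      by exists s.
    rewrite fmorph_div rmorphB /= st addrK mulrC mulKf //.
    by rewrite fmorph_eq0.
  have oS := open_setC_ratr fS.
  have [sre sim] := (smooth_onP _ _).1 sH.
  apply/smooth_onP; split.
    by move=> k x /sA; exact: (smooth_real_affine oS sre).
  by move=> k x /sA; exact: (smooth_real_affine oS sim).
- move=> x Dx nS; rewrite -rmorphM -rmorphD /= eH // => Sx; apply: nS.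
  by exists (a * x + b) => //; rewrite addrK mulrC mulKf.
Qed.
End ExtendsSmoothly.

(** * Matrices of size two *)

Section TwoByTwo.
Variable K : comRingType.
Implicit Types A B : 'M[K]_2.

Definition mx22 (a b c d : K) : 'M[K]_2 :=
  \matrix_(i, j) if i == 0 then (if j == 0 then a else b)
                 else (if j == 0 then c else d).

Lemma mx22E a b c d : (mx22 a b c d 0 0 = a) * (mx22 a b c d 0 1 = b) *
  (mx22 a b c d 1 0 = c) * (mx22 a b c d 1 1 = d).
Proof. by rewrite !mxE. Qed.

Lemma sum_ord2 (V : nmodType) (F : 'I_2 -> V) : \sum_i F i = F 0 + F 1.
Proof.
by rewrite !big_ord_recl big_ord0 addr0; congr (_ + F _); apply/val_inj.
Qed.

Lemma mulmx22E A B i j : (A *m B) i j = A i 0 * B 0 j + A i 1 * B 1 j.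
Proof. by rewrite mxE sum_ord2. Qed.

Lemma eq_mx22 A B : A 0 0 = B 0 0 -> A 0 1 = B 0 1 -> A 1 0 = B 1 0 ->
  A 1 1 = B 1 1 -> A = B.
Proof.
have ord2P (i : 'I_2) : i = 0 \/ i = 1.
  by case: i => -[|[|//]] ?; [left|right]; apply/val_inj.
move=> *; apply/matrixP => i j.
by case: (ord2P i) => ->; case: (ord2P j) => ->.
Qed.

Lemma det22 A : \det A = A 0 0 * A 1 1 - A 0 1 * A 1 0.
Proof.
rewrite (expand_det_row A 0) sum_ord2 /cofactor !det_mx11 !mxE /=.
rewrite (_ : lift 0 0 = 1); last exact/val_inj.
rewrite (_ : lift 1 0 = 0); last exact/val_inj.
by rewrite addn0 add0n expr0 expr1 mul1r mulN1r mulrN.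
Qed.
End TwoByTwo.

(** * Coset representatives for integer matrices of determinant n *)

Section HermiteNormalForm.
Variable n : nat.
Hypothesis n_gt0 : (0 < n)%N.

(* The pair (d, b) stands for the matrix [[n/d, b], [0, d]]. *)
Definition hecke_index : seq (nat * nat) :=
  [seq (d, b) | d <- divisors n, b <- iota 0 d].

Lemma mem_hecke_index i : (i \in hecke_index) = (i.1 %| n)%N && (i.2 < i.1)%N.
Proof.
case: i => d b; rewrite dvdn_divisors //=; apply/allpairsPdep/andP.
  by move=> [d' [b' [d'n b'd' [-> ->]]]]; rewrite mem_iota in b'd'.
by move=> [dn bd]; exists d, b; rewrite mem_iota.
Qed.

Lemma hecke_index_uniq : uniq hecke_index.
Proof.
apply: allpairs_uniq_dep; first exact: divisors_uniq.
  by move=> d _; exact: iota_uniq.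
by move=> [d b] [d' b'] _ _ /= [-> ->].
Qed.

Definition hnf (i : nat * nat) : 'M[int]_2 :=
  mx22 (n %/ i.1)%N%:Z i.2%:Z 0 i.1%:Z.

Lemma det_hnf i : i \in hecke_index -> \det (hnf i) = n%:Z.
Proof.
rewrite mem_hecke_index => /andP[dn _].
by rewrite det22 !mx22E mulr0 subr0 -PoszM divnK.
Qed.

(** Row reduction: the gcd [e] of the first column and its Bezout coefficients give a matrix of
    determinant 1 that clears the lower left entry; a translation then reduces the upper right entry
    modulo [d]. *)
Lemma hnf_exists (M : 'M[int]_2) : \det M = n%:Z ->
  exists i, exists g : 'M[int]_2,
    [/\ i \in hecke_index, \det g = 1 & M = g *m hnf i].
Proof.
rewrite det22.
set p := M 0 0; set q := M 0 1; set r := M 1 0; set s := M 1 1 => detM.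
have [u [v]] := Bezoutz p r; set e := gcdz p r => bez.
have /dvdzP[p' pE] : (e %| p)%Z by exact: dvdz_gcdl.
have /dvdzP[r' rE] : (e %| r)%Z by exact: dvdz_gcdr.
(* Left multiplication by [[[u, v], [-r', p']]] turns [M] into [[[e, t], [0, d]]]. *)
pose d := p' * s - r' * q; pose t := u * q + v * s.
have edn : e * d = n%:Z by rewrite -detM pE rE /d; ring.
have e_gt0 : 0 < e.
  rewrite lt_neqAle; apply/andP; split; last by rewrite /e /gcdz.
  by apply: contra_eq_neq edn => <-; rewrite mul0r eq_sym; lia.
have d_gt0 : 0 < d by rewrite -(pmulr_rgt0 _ e_gt0) edn; lia.
have bez1 : u * p' + v * r' = 1.
  apply: (mulIf (lt0r_neq0 e_gt0)).
  by rewrite mul1r -{2}bez pE rE; ring.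
have b_ge0 : 0 <= (t %% d)%Z by rewrite modz_ge0 // lt0r_neq0.
have b_ltd : (t %% d)%Z < d by rewrite ltz_pmod.
have dE : `|d|%N%:Z = d by rewrite gez0_abs // ltW.
have bE : `|(t %% d)%Z|%N%:Z = (t %% d)%Z by rewrite gez0_abs.
have eE : `|e|%N%:Z = e by rewrite gez0_abs // ltW.
have nE : n = (`|e| * `|d|)%N by apply/eqP; rewrite -eqz_nat PoszM eE dE edn.
pose k := (t %/ d)%Z.
(* The second witness is the inverse [[[p', -v], [r', u]]] of the reducing matrix times [[[1, k],
   [0, 1]]], which undoes the reduction of [t] modulo [d]. *)
exists (`|d|%N, `|(t %% d)%Z|%N), (mx22 p' (p' * k - v) r' (r' * k + u)); split.
- rewrite mem_hecke_index /= {1}nE dvdn_mull //=.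
  by rewrite -ltz_nat bE dE.
- by rewrite det22 !mx22E -bez1; ring.
- have tE : t = k * d + (t %% d)%Z := divz_eq t d.
  have nd : (n %/ `|d|)%N = `|e|%N by rewrite {1}nE mulnK // absz_gt0 lt0r_neq0.
  have bE' : (t %% d)%Z = t - k * d by rewrite {2}tE addrC addKr.
  apply: eq_mx22; rewrite mulmx22E !mx22E /= ?nd ?eE ?bE ?dE ?bE'
    -/p -/q -/r -/s.
  + by rewrite mulr0 addr0.
  + rewrite -[LHS]mul1r -bez1 /t /d; ring.
  + by rewrite mulr0 addr0.
  + rewrite -[LHS]mul1r -bez1 /t /d; ring.
Qed.

(** The zero lower left entries force [g] to be upper triangular; positive diagonals and determinant
    1 make it unipotent. The upper right entries are then congruent modulo [d] and already
    reduced. *)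
Lemma hnf_unique i j (g : 'M[int]_2) : i \in hecke_index -> j \in hecke_index ->
  \det g = 1 -> hnf i = g *m hnf j -> i = j.
Proof.
case: i j => [d b] [d' b']; rewrite !mem_hecke_index /= det22.
move=> /andP[dn bd] /andP[d'n b'd'] detg eqh.
have d_gt0 : (0 < d)%N by case: (d) bd.
have d'_gt0 : (0 < d')%N by case: (d') b'd'.
have a_gt0 : (0 < n %/ d)%N by rewrite divn_gt0 // dvdn_leq.
have a'_gt0 : (0 < n %/ d')%N by rewrite divn_gt0 // dvdn_leq.
move: (congr1 (fun A : 'M[int]_2 => A 0 0) eqh)
  (congr1 (fun A : 'M[int]_2 => A 0 1) eqh)
  (congr1 (fun A : 'M[int]_2 => A 1 0) eqh)
  (congr1 (fun A : 'M[int]_2 => A 1 1) eqh).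
rewrite !mulmx22E !mx22E /= !mulr0 !addr0 => e00 e01 e10 e11.
have g10 : g 1 0 = 0.
  by have /esym/eqP := e10; rewrite mulf_eq0 => /orP[/eqP//|]; lia.
rewrite g10 mulr0 subr0 in detg; rewrite g10 mul0r add0r in e11.
have g00_gt0 : 0 < g 0 0 by rewrite -(@pmulr_lgt0 _ (n %/ d')%N%:Z) -?e00; lia.
have g11_gt0 : 0 < g 1 1 by rewrite -(pmulr_rgt0 _ g00_gt0) detg.
have [g00 g11] : g 0 0 = 1 /\ g 1 1 = 1.
  by move: (g 0 0) (g 1 1) detg g00_gt0 g11_gt0; clear=> x y; nia.
move: e11 e01; rewrite g11 g00 !mul1r => -[dd']; rewrite dd' in bd *.
move=> /(congr1 (fun z => modz z d')).
by rewrite addrC modzMDl !modz_small //= => [[->]].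
Qed.

(** Right multiplication by [g] commutes with left multiplication by SL_2(Z), so it permutes the
    cosets, and hence their representatives up to left factors. *)
Lemma hnf_right_mul (g : 'M[int]_2) : \det g = 1 ->
  exists gam : nat * nat -> 'M[int]_2,
    (forall i, i \in hecke_index -> \det (gam i) = 1) /\
    perm_eq [seq hnf i *m g | i <- hecke_index]
            [seq gam i *m hnf i | i <- hecke_index].
Proof.
move=> detg.
have gU : g \in unitmx by rewrite unitmxE detg unitr1.
(* [p j] holds the index whose coset [g] sends to that of [j], and the left factor; both come from
   reducing [hnf j *m invmx g]. Outside [hecke_index] the value is arbitrary. *)
have /choice[p pP] : forall j, exists p : (nat * nat) * 'M[int]_2,
    j \in hecke_index ->
    [/\ p.1 \in hecke_index, \det p.2 = 1 & hnf p.1 *m g = p.2 *m hnf j].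
  move=> j; have [jI|] := boolP (j \in hecke_index); last by exists (j, 0).
  have [|i [h [iI deth hE]]] := hnf_exists (M := hnf j *m invmx g).
    by rewrite det_mulmx det_inv detg invr1 mulr1 det_hnf.
  have hU : h \in unitmx by rewrite unitmxE deth unitr1.
  exists (i, invmx h) => _; split=> //=; first by rewrite det_inv deth invr1.
  apply: (can_inj (mulKmx hU)).
  by rewrite mulmxA -hE mulmxKV // mulKVmx.
exists (fun j => (p j).2); split=> [j /pP[]//|].
have -> : [seq (p i).2 *m hnf i | i <- hecke_index] =
    [seq hnf i *m g | i <- [seq (p j).1 | j <- hecke_index]].
  by rewrite -map_comp; apply/eq_in_map => j /pP[].
apply: perm_map; rewrite perm_sym.
(* Equal first components would put [hnf i] and [hnf j] in one coset. *)
have pinj : {in hecke_index &, injective (fun j => (p j).1)}.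
  move=> i j iI jI eij.
  have [_ di ei] := pP i iI; have [_ dj ej] := pP j jI.
  have iU : (p i).2 \in unitmx by rewrite unitmxE di unitr1.
  apply: (@hnf_unique _ _ (invmx (p i).2 *m (p j).2)) => //.
    by rewrite det_mulmx det_inv di dj invr1 mulr1.
  by rewrite -mulmxA -ej -eij ei mulKmx.
have su : uniq [seq (p j).1 | j <- hecke_index].
  by rewrite map_inj_in_uniq // hecke_index_uniq.
apply: uniq_perm => //; first exact: hecke_index_uniq.
(* An injective map from a finite set to itself is a permutation. *)
have [||//] := uniq_min_size su (s2 := hecke_index).
  by move=> _ /mapP[j /pP[? _ _] ->].
by rewrite size_map.
Qed.
End HermiteNormalForm.

Lemma natr_divisor_neq0 n d : (0 < n)%N ->
  d \in divisors n -> d%:R != 0 :> rat.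
Proof.
move=> n_gt0.
by rewrite -dvdn_divisors // pnatr_eq0; case: d => //; rewrite dvd0n; lia.
Qed.

(** * The homogeneous function on Q^2 attached to f *)

Section HomogeneousExtension.
Variables (R : realType) (w : nat) (f : rat -> R[i]) (C : R[i]).
Local Notation K := R[i].

Definition act (g : 'M[int]_2) (v : rat * rat) : rat * rat :=
  ((g 0 0)%:~R * v.1 + (g 0 1)%:~R * v.2,
   (g 1 0)%:~R * v.1 + (g 1 1)%:~R * v.2).

Definition scale2 (t : rat) (v : rat * rat) : rat * rat := (t * v.1, t * v.2).

Lemma act_mulmx g h v : act (g *m h) v = act g (act h v).
Proof. by rewrite /act !mulmx22E !rmorphD !rmorphM /=; congr (_, _); ring. Qed.

Lemma act_scale g t v : act g (scale2 t v) = scale2 t (act g v).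
Proof. by rewrite /act /scale2 /=; congr (_, _); ring. Qed.

(* C is the value attached to the cusp at infinity, where f is undefined. *)
Definition homext (v : rat * rat) : K :=
  if v.2 == 0 then ratr v.1 ^+ w * C else ratr v.2 ^+ w * f (v.1 / v.2).

Lemma homext_scale t v : t != 0 ->
  homext (scale2 t v) = ratr t ^+ w * homext v.
Proof.
move=> t0; rewrite /homext /= mulf_eq0 (negPf t0) /=.
case: eqP => [_|/eqP v0]; first by rewrite rmorphM exprMn mulrA.
by rewrite rmorphM exprMn mulrA -mulf_div divff // mul1r.
Qed.

Lemma homext1 x : homext (x, 1) = f x.
Proof. by rewrite /homext /= rmorph1 expr1n mul1r divr1. Qed.

Lemma act_affine g x : aut_den g x != 0 ->
  act g (x, 1) = scale2 (aut_den g x) (moebius g x, 1).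
Proof.
by move=> j0; rewrite /act /scale2 /= !mulr1 [_ * moebius g x]mulrC divfK.
Qed.

Lemma homext_act g x : aut_den g x != 0 ->
  homext (act g (x, 1)) = ratr (aut_den g x) ^+ w * f (moebius g x).
Proof. by move=> j0; rewrite act_affine // homext_scale // homext1. Qed.

Section Hecke.
Variable n : nat.
Hypothesis n_gt0 : (0 < n)%N.

Lemma hecke_index_gt0 i : i \in hecke_index n -> (0 < i.1)%N.
Proof. by rewrite mem_hecke_index // => /andP[_]; case: i.1. Qed.

Definition hnf_point (i : nat * nat) (x : rat) : rat :=
  ((n %/ i.1)%:R * x + i.2%:R) / i.1%:R.

Lemma act_hnf i x : i \in hecke_index n ->
  act (hnf n i) (x, 1) = scale2 i.1%:R (hnf_point i x, 1).
Proof.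
move=> /hecke_index_gt0 i0; rewrite /act /hnf !mx22E /scale2 /hnf_point /=.
rewrite !mulr1 mul0r add0r; congr (_, _).
by rewrite [RHS]mulrC divfK // pnatr_eq0 -lt0n.
Qed.

(** Homogeneity absorbs the factor [d%:R ^+ w]. The second coordinates are the nonzero [d], so any
    value [C] at the cusp is allowed. *)
Lemma hecke_inftyE x :
  hecke_infty w n f x = \sum_(i <- hecke_index n) homext (act (hnf n i) (x, 1)).
Proof.
rewrite /hecke_infty big_allpairs_dep; apply: eq_big_seq => /= d dn.
have d0 := natr_divisor_neq0 n_gt0 dn.
rewrite mulr_sumr -(big_mkord xpredT (fun b : nat =>
  d%:R ^+ w * f (((n %/ d)%:R * x + b%:R) / d%:R))) /index_iota subn0.
apply: eq_big_seq => b; rewrite mem_iota /= => bd.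
have ib : (d, b) \in hecke_index n.
  by rewrite mem_hecke_index //= bd dvdn_divisors // dn.
by rewrite act_hnf // homext_scale // homext1 ratr_nat.
Qed.

(** The automorphy factor is the scalar relating [act g (x, 1)] to [(moebius g x, 1)], so
    homogeneity absorbs it as well. *)
Lemma hecke_infty_slash g x : aut_den g x != 0 ->
  ratr (aut_den g x) ^+ w * hecke_infty w n f (moebius g x) =
  \sum_(i <- hecke_index n) homext (act (hnf n i *m g) (x, 1)).
Proof.
move=> j0; rewrite hecke_inftyE mulr_sumr; apply: eq_bigr => i _.
by rewrite act_mulmx (act_affine j0) act_scale homext_scale.
Qed.

End Hecke.
End HomogeneousExtension.

(** * Periods of the Hecke transform *)

Section HeckePeriods.
Variables (R : realType) (w n : nat) (f : rat -> R[i]).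
Hypothesis n_gt0 : (0 < n)%N.

(** Natural multiples are repeated sums, and the weights [d ^ w] are natural numbers. *)
Lemma extends_smoothly_mulrn D (h : rat -> R[i]) m :
  extends_smoothly D h -> extends_smoothly D (fun x => h x *+ m).
Proof.
move=> hD.
have := @extends_smoothly_sum _ _ (iota 0 m) D (fun=> h) (fun _ _ => hD).
by apply: extends_smoothly_sub => // x _;
  rewrite big_const_seq count_predT size_iota iter_addr_0.
Qed.

(** The second clause ensures that no summand is evaluated at the cusp, so that each one is a
    multiple of a genuine period of [f]. *)
Lemma hecke_period (C : R[i]) (g : 'M[int]_2) : \det g = 1 ->
  exists gam : nat * nat -> 'M[int]_2,
  [/\ forall i, i \in hecke_index n -> \det (gam i) = 1,
      forall i x, i \in hecke_index n -> aut_den g x != 0 ->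
        aut_den (gam i) (hnf_point n i x) != 0 &
      forall x, aut_den g x != 0 ->
        period_fun w (hecke_infty w n f) g x =
        \sum_(i <- hecke_index n)
          (homext w f C (act (hnf n i) (x, 1)) -
           homext w f C (act (gam i) (act (hnf n i) (x, 1))))].
Proof.
move=> /(hnf_right_mul n_gt0)[gam [detgam pgam]]; exists gam; split=> //.
  move=> i x iI j0.
  (* [gam i *m hnf n i] equals some [hnf n k *m g]; compare the second coordinates of the images of
     [(x, 1)]. *)
  have : gam i *m hnf n i \in [seq hnf n k *m g | k <- hecke_index n].
    by rewrite (perm_mem pgam); apply: map_f.
  move=> /mapP[k kI] /(congr1 (fun M => (act M (x, 1)).2)).
  rewrite !act_mulmx act_hnf // act_scale (act_affine j0) act_scale /=.
  rewrite !mulr1 mx22E mul0r add0r => e.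
  have k0 := hecke_index_gt0 n_gt0 kI.
  have : i.1%:R * aut_den (gam i) (hnf_point n i x) != 0.
    by rewrite e mulf_neq0 // intr_eq0 mx22E; exact: lt0n_neq0.
  by rewrite mulf_eq0 negb_or => /andP[].
move=> x j0; rewrite sumrB /period_fun (hecke_inftyE w f C n_gt0).
rewrite (hecke_infty_slash w f C n_gt0 j0); congr (_ - _).
rewrite -(big_map (fun i => hnf n i *m g) xpredT
  (fun M => homext w f C (act M (x, 1)))) (perm_big _ pgam) big_map.
by apply: eq_bigr => i _; rewrite act_mulmx.
Qed.

Lemma homext_hnf_period (C : R[i]) (gam : 'M[int]_2) i x :
  i \in hecke_index n -> aut_den gam (hnf_point n i x) != 0 ->
  homext w f C (act (hnf n i) (x, 1)) -
    homext w f C (act gam (act (hnf n i) (x, 1))) =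
  period_fun w f gam (hnf_point n i x) *+ i.1 ^ w.
Proof.
move=> iI j0; have i0 : i.1%:R != 0 :> rat.
  by rewrite pnatr_eq0 -lt0n (hecke_index_gt0 n_gt0 iI).
rewrite act_hnf // act_scale !homext_scale // homext1 homext_act //.
by rewrite -mulrBr ratr_nat -natrX mulr_natl.
Qed.

Lemma quantum_modular_hecke :
  quantum_modular w f -> quantum_modular w (hecke_infty w n f).
Proof.
(* The value 0 at the cusp is an arbitrary choice: [dengam] keeps all points away from it. *)
move=> qf g /(hecke_period 0)[gam [detgam dengam pE]].
apply: (extends_smoothly_sub (D := [set x | aut_den g x != 0])
  (h := fun x => \sum_(i <- hecke_index n)
    period_fun w f (gam i) (hnf_point n i x) *+ i.1 ^ w)) => //.
  move=> x; rewrite inE /= => j0; rewrite pE //.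
  by apply: eq_big_seq => i iI; rewrite homext_hnf_period // dengam.
apply: extends_smoothly_sum => i iI; apply: extends_smoothly_mulrn.
have iP := hecke_index_gt0 n_gt0 iI.
have a0 : (n %/ i.1)%:R / i.1%:R != 0 :> rat.
  move: iI; rewrite mem_hecke_index // => /andP[in_ _].
  by rewrite mulf_neq0 ?invr_eq0 ?pnatr_eq0 -?lt0n // divn_gt0 // dvdn_leq.
have ptE x : (n %/ i.1)%:R / i.1%:R * x + i.2%:R / i.1%:R = hnf_point n i x.
  by rewrite /hnf_point mulrDl mulrAC.
apply: extends_smoothly_sub
  (extends_smoothly_affine (i.2%:R / i.1%:R) a0 (qf _ (detgam i iI))).
  by move=> x /= j0; rewrite ptE; apply: dengam.
by move=> x _; rewrite ptE.
Qed.

(** Replacing [x] by [x + 1] shifts [b] by [n / d]. As [f] has period 1, the summand depends only on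
    [b] modulo [d], and a cyclic shift preserves the sum. *)
Lemma hecke_periodic : (forall x, f (x + 1) = f x) ->
  forall x, hecke_infty w n f (x + 1) = hecke_infty w n f x.
Proof.
move=> f1 x; apply: eq_big_seq => d dn; congr (_ * _).
have d0 := natr_divisor_neq0 n_gt0 dn.
pose phi b := f (((n %/ d)%:R * x + b%:R) / d%:R).
have phi_per b : phi (b + d)%N = phi b.
  by rewrite /phi natrD addrA mulrDl divff // f1.
have shift a : \sum_(b < d) phi (a + b)%N = \sum_(b < d) phi b.
  elim: a => [//|a <-]; rewrite -!(big_mkord xpredT (fun b => phi (_ + b)%N)).
  case: (d) d0 phi_per => [//|m] _ phi_per.
  (* The last term on the left and the first on the right differ by a full period. *)
  rewrite big_nat_recr // [RHS]big_nat_recl //= addn0 [RHS]addrC.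
  rewrite addSnnS phi_per; congr (_ + _).
  by apply: eq_bigr => i _; rewrite addSnnS.
rewrite -[RHS](shift (n %/ d)%N); apply: eq_bigr => b _.
by rewrite /phi natrD mulrDr mulr1 addrA.
Qed.
End HeckePeriods.

(** * Functions on Q^2 that are polynomial on lines *)

Section PolynomialOnLines.
Variables (R : realType) (w : nat).
Local Notation K := R[i].
Implicit Types P : rat * rat -> K.

(* Restricting to affine lines makes stability under linear substitutions
   immediate. *)
Definition polynomial_on_lines P := forall p0 p1 q0 q1 : rat,
  exists2 Q : {poly K}, (size Q <= w.+1)%N &
    forall t, P (p0 + p1 * t, q0 + q1 * t) = Q.[ratr t].

Lemma polynomial_on_lines0 P : (forall v, P v = 0) -> polynomial_on_lines P.
Proof. by move=> P0 *; exists 0 => [|t]; rewrite ?size_poly0 // P0 horner0. Qed.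

Lemma polynomial_on_linesD P P' : polynomial_on_lines P ->
  polynomial_on_lines P' -> polynomial_on_lines (fun v => P v + P' v).
Proof.
move=> hP hP' p0 p1 q0 q1.
have [Q sQ QE] := hP p0 p1 q0 q1; have [Q' sQ' QE'] := hP' p0 p1 q0 q1.
exists (Q + Q'); last by move=> t; rewrite QE QE' hornerD.
by apply: leq_trans (size_polyD _ _) _; rewrite geq_max sQ.
Qed.

Lemma polynomial_on_lines_act P g : polynomial_on_lines P ->
  polynomial_on_lines (fun v => P (act g v)).
Proof.
move=> hP p0 p1 q0 q1.
have [Q sQ QE] := hP ((g 0 0)%:~R * p0 + (g 0 1)%:~R * q0)
  ((g 0 0)%:~R * p1 + (g 0 1)%:~R * q1) ((g 1 0)%:~R * p0 + (g 1 1)%:~R * q0)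
  ((g 1 0)%:~R * p1 + (g 1 1)%:~R * q1).
exists Q => // t; rewrite -QE /act /=; congr (P _); congr (_, _); ring.
Qed.

(** On a line both coordinates become polynomials [L] of degree at most 1, so each monomial has
    degree at most [j + (w - j) = w]. *)
Lemma polynomial_on_lines_form (c : 'I_w.+1 -> K) :
  polynomial_on_lines
    (fun v => \sum_(j < w.+1) c j * (ratr v.1 ^+ j * ratr v.2 ^+ (w - j))).
Proof.
move=> p0 p1 q0 q1.
pose L (a b : rat) : {poly K} := (ratr a)%:P + (ratr b)%:P * 'X.
have LE a b t : (L a b).[ratr t] = ratr (a + b * t).
  by rewrite hornerD hornerMX !hornerC [RHS]rmorphD /= [in RHS]rmorphM.
have sL1 a b : (size (L a b) <= 2)%N.
  apply: leq_trans (size_polyD _ _) _; rewrite geq_max mul_polyC.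
  rewrite (leq_trans (size_polyC_leq1 _)) //.
  by apply: leq_trans (size_scale_leq _ _) _; rewrite size_polyX.
have sL a b m : (size (L a b ^+ m) <= m.+1)%N.
  apply: leq_trans (size_poly_exp_leq _ _) _; rewrite ltnS -[leqRHS]mul1n.
  by apply: leq_mul => //; have := sL1 a b; lia.
exists (\sum_(j < w.+1) c j *: (L p0 p1 ^+ j * L q0 q1 ^+ (w - j))).
  apply: leq_trans (size_sum _ _ _) _; apply/bigmax_leqP => j _.
  apply: leq_trans (size_scale_leq _ _) _.
  apply: leq_trans (size_polyMleq _ _) _.
  have := leq_add (sL p0 p1 j) (sL q0 q1 (w - j)%N).
  by have := ltn_ord j; lia.
move=> t; rewrite horner_sum; apply: eq_bigr => j _.
by rewrite hornerZ hornerM !horner_exp !LE.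
Qed.

End PolynomialOnLines.

(** * Polynomial periods for all of SL_2(Z) *)

Section PolynomialPeriods.
Variables (R : realType) (w : nat) (f : rat -> R[i]) (c : 'I_w.+1 -> R[i]).
Hypotheses (w_gt0 : (0 < w)%N) (w_even : ~~ odd w).
Hypothesis f1 : forall x, f (x + 1) = f x.
Hypothesis fS : forall x : rat, x != 0 ->
  f x - ratr x ^+ w * f (- 1 / x) = \sum_(j < w.+1) c j * ratr x ^+ j.
Local Notation K := R[i].
(** Up to the factor [q^w], the inversion formula at [(0, q)] reads [f 0 - C = c ord0], which forces
    this value. *)
Local Notation C := (f 0 - c ord0).
Local Notation F := (homext w f C).

(* Substituting [-1/x] for [x] in [fS] gives [P x + x^w P(-1/x) = 0] for the
   period polynomial [P]; compare constant coefficients. *)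
Lemma period_poly_coef : c ord_max = - c ord0.
Proof.
pose Q : {poly K} :=
  \sum_(j < w.+1) (c j *: 'X^j + ((-1) ^+ j * c j) *: 'X^(w - j)).
have Q0 x : x != 0 -> Q.[ratr x] = 0.
  move=> x0; have rx0 : ratr x != 0 :> K by rewrite fmorph_eq0.
  have x0' : - 1 / x != 0 by rewrite mulf_neq0 ?invr_eq0 // oppr_eq0 oner_eq0.
  have := fS x0'; rewrite (_ : - 1 / (- 1 / x) = x); last by field.
  move=> /(congr1 (fun z => ratr x ^+ w * z)); rewrite mulrBr mulrA -exprMn.
  rewrite -rmorphM /= (_ : x * (- 1 / x) = -1); last by field.
  rewrite rmorphN1 -signr_odd (negPf w_even) mul1r => e.
  rewrite /Q horner_sum; under eq_bigr do rewrite hornerD !hornerZ !hornerXn.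
  rewrite big_split /= -fS // (_ : \sum_(i < _) _ =
    ratr x ^+ w * \sum_(j < w.+1) c j * ratr (- 1 / x) ^+ j).
    by rewrite -e; ring.
  rewrite mulr_sumr; apply: eq_bigr => j _.
  rewrite (_ : ratr (- 1 / x) = - 1 * (ratr x)^-1); last first.
    by rewrite !mulN1r rmorphN fmorphV.
  move: (ratr x) rx0 => y y0; rewrite exprMn exprVn.
  have jw : (j <= w)%N by rewrite -ltnS.
  have -> : y ^+ w = y ^+ (w - j) * y ^+ j by rewrite -exprD subnK.
  move: (y ^+ (w - j)) (y ^+ j) (expf_neq0 j y0) => a b b0.
  by field.
(* The integers from 1 to [size Q] would be too many distinct roots. *)
have /eqP Qz : Q == 0.
  apply/negPn/negP => Qn0.
  have := @max_poly_roots _ Q [seq ratr k.+1%:R | k <- iota 0 (size Q)] Qn0.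
  rewrite size_map size_iota ltnn => H; suff : false by []; apply: H.
    apply/allP => _ /mapP[k _ ->]; apply/rootP/Q0; by rewrite pnatr_eq0.
  rewrite map_inj_uniq ?iota_uniq // => a b /fmorph_inj /eqP.
  by rewrite eqr_nat => /eqP[].
have := congr1 (fun q : {poly K} => q`_0) Qz.
rewrite coef0 coef_sum; under eq_bigr do rewrite coefD !coefZ !coefXn.
(* Only [j = 0] in the first sum and [j = w] in the second reach the constant coefficient, the
   latter with sign [(-1)^w = 1]. *)
rewrite big_split /= (bigD1 ord0) //= big1 => [|j j0]; last first.
  by rewrite eq_sym (_ : (j == 0 :> nat) = false) ?mulr0 //; apply: negPf j0.
rewrite (bigD1 ord_max) //= big1 => [|j jw]; last first.
  have : (j : nat) != w by apply: contra jw => /eqP jw; apply/eqP/val_inj.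
  move=> jw'; rewrite (_ : (_ == _) = false) ?mulr0 //.
  by have := ltn_ord j; lia.
rewrite subnn !mulr1 !addr0 -signr_odd (negPf w_even) mul1r => /eqP.
by rewrite addrC addr_eq0 => /eqP.
Qed.

Lemma f_addz x (k : int) : f (x + k%:~R) = f x.
Proof.
have fN m y : f (y + m%:R) = f y.
  by elim: m y => [|m IH] y; rewrite ?addr0 // mulrSr addrA f1.
case: k => m; first by rewrite -pmulrn fN.
by rewrite NegzE mulrNz -pmulrn -[in RHS](subrK m.+1%:R x) fN.
Qed.

Lemma homext_translate (k : int) p q : F (p + k%:~R * q, q) = F (p, q).
Proof.
rewrite /homext /=; case: eqP => [->|/eqP q0]; first by rewrite mulr0 addr0.
by rewrite mulrDl mulfK // f_addz.
Qed.

(** In even weight the scalar -1 acts trivially; this handles the negatives of translations in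
    [homext_period_polynomial]. *)
Lemma homextN p q : F (- p, - q) = F (p, q).
Proof.
have := homext_scale w f C (p, q) (t := -1).
rewrite /scale2 /= !mulN1r => -> //.
by rewrite rmorphN1 -signr_odd (negPf w_even) mul1r.
Qed.

(** Off the axes this is [fS] at [p / q] times [q^w]. For [p = 0] it holds by the choice of [C], for
    [q = 0] by [period_poly_coef], and at the origin both sides vanish because [w > 0]. *)
Lemma homext_inversion p q :
  F (p, q) - F (- q, p) =
  \sum_(j < w.+1) c j * (ratr p ^+ j * ratr q ^+ (w - j)).
Proof.
have w0 : (w == 0%N) = false by lia.
(* Since [0 ^+ 0 = 1], exactly one end term of the form survives on each axis. *)
have low (b : K) :
    \sum_(j < w.+1) c j * (0 ^+ j * b ^+ (w - j)) = c ord0 * b ^+ w.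
  rewrite (bigD1 ord0) //= big1 => [|j j0]; last first.
    rewrite expr0n (_ : (j == 0 :> nat) = false) ?mul0r ?mulr0 //.
    exact: negPf j0.
  by rewrite expr0 mul1r subn0 addr0.
have high (a : K) :
    \sum_(j < w.+1) c j * (a ^+ j * 0 ^+ (w - j)) = c ord_max * a ^+ w.
  rewrite (bigD1 ord_max) //= big1 => [|j jw]; last first.
    have : (j : nat) != w by apply: contra jw => /eqP jw; apply/eqP/val_inj.
    move=> jw'; rewrite expr0n (_ : (_ == _) = false) ?mulr0 //.
    by have := ltn_ord j; lia.
  by rewrite subnn expr0 mulr1 addr0.
rewrite /homext /=.
have [->|q0] := eqVneq q 0; have [->|p0] := eqVneq p 0.
- by rewrite oppr0 subrr rmorph0 low expr0n w0 mulr0.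
- rewrite rmorph0 high period_poly_coef oppr0 mul0r -mulrBr mulrC.
  by congr (_ * _); ring.
- rewrite rmorph0 low mul0r rmorphN exprNn -signr_odd (negPf w_even) mul1r.
  by rewrite -mulrBr mulrC; congr (_ * _); ring.
- have pq0 : p / q != 0 by rewrite mulf_neq0 ?invr_eq0.
  have qr0 : ratr q != 0 :> K by rewrite fmorph_eq0.
  transitivity (ratr q ^+ w *
      (f (p / q) - ratr (p / q) ^+ w * f (- 1 / (p / q)))).
    rewrite mulrBr mulrA -exprMn -rmorphM /= [q * _]mulrC divfK //.
    by rewrite invf_div mulrA mulN1r.
  rewrite fS // mulr_sumr fmorph_div /=; apply: eq_bigr => j _.
  have jw : (j <= w)%N by rewrite -ltnS.
  move: (ratr p) (ratr q) qr0 => a b b0; rewrite exprMn exprVn.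
  have -> : b ^+ w = b ^+ (w - j) * b ^+ j by rewrite -exprD subnK.
  move: (b ^+ (w - j)) (b ^+ j) (expf_neq0 j b0) (a ^+ j) => y z z0 x.
  by field.
Qed.

(** Induction on the size of [g 1 0]: [g] is a translation times the inversion times some [h] with
    smaller lower left entry. The difference telescopes through [F (act h v)]; the induction
    hypothesis covers the first part, and the second is the form of [homext_inversion] at
    [act h v]. *)
Lemma homext_period_polynomial (g : 'M[int]_2) : \det g = 1 ->
  polynomial_on_lines w (fun v => F v - F (act g v)).
Proof.
have [m] := ubnP `|g 1 0|; elim: m g => // m IH g; rewrite ltnS => gm.
rewrite det22 => detg.
have [g10|g10] := eqVneq (g 1 0) 0.
  rewrite g10 mulr0 subr0 in detg.
  (* Base case: plus or minus a translation, under which [F] is invariant. *)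
  have [[g00 g11]|[g00 g11]] :
      (g 0 0 = 1 /\ g 1 1 = 1) \/ (g 0 0 = -1 /\ g 1 1 = -1).
  - move: (g 0 0) (g 1 1) detg; clear=> x y xy.
    have /eqP := congr1 absz xy; rewrite abszM muln_eq1 => /andP[/eqP x1 _].
    have [x1'|x1'] : x = 1 \/ x = -1 by lia.
      by left; split=> //; move: xy; rewrite x1' mul1r.
    by right; split=> //; move: xy; rewrite x1' mulN1r; lia.
  - apply: polynomial_on_lines0 => -[p q].
    by rewrite /act g10 g00 g11 /= mul0r add0r !mul1r homext_translate subrr.
  apply: polynomial_on_lines0 => -[p q].
  rewrite /act g10 g00 g11 /= mul0r add0r !mulN1r.
  by rewrite -[g 0 1]opprK mulrNz mulNr -opprD homextN homext_translate subrr.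
pose k := (g 0%R 0%R %/ g 1%R 0%R)%Z.
(* Translate [g] by [-k], then apply the inverse of the inversion; the new lower left entry is minus
   the remainder of [g 0 0] modulo [g 1 0]. *)
pose h := mx22 (g 1 0) (g 1 1) (- (g 0 0 - k * g 1 0)) (- (g 0 1 - k * g 1 1)).
have deth : \det h = 1 by rewrite det22 !mx22E -detg; ring.
have hm : (absz (h 1%R 0%R) < m)%N.
  rewrite mx22E abszN; have := modz_ge0 (g 0%R 0%R) g10.
  have := ltz_mod (g 0%R 0%R) g10.
  by rewrite /modz -/k; lia.
have gE v : act g v = ((- (act h v).2) + k%:~R * (act h v).1, (act h v).1).
  rewrite /act !mx22E !rmorphN !rmorphB !rmorphM /=; congr (_, _); ring.
have := polynomial_on_lines_act h (polynomial_on_lines_form c).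
move=> /(polynomial_on_linesD (IH h hm deth)) H p0 p1 q0 q1.
have [Q sQ QE] := H p0 p1 q0 q1; exists Q => // t; rewrite -QE.
rewrite gE homext_translate; set v := (_, _).
by rewrite -homext_inversion -surjective_pairing; ring.
Qed.
End PolynomialPeriods.

(** * The Hecke transform preserves polynomial periods *)

Section HeckePolynomialPeriod.
Variables (R : realType) (w n : nat).
Hypotheses (w_gt0 : (0 < w)%N) (w_even : ~~ odd w) (n_gt0 : (0 < n)%N).

(** The wanted formula is the period at the inversion [S]. Its summands are polynomial on lines, and
    [x] runs along the line of points [(x, 1)]. *)
Lemma quantum_modular_poly_p_hecke (f : rat -> R[i]) :
  quantum_modular_poly_p w f -> quantum_modular_poly_p w (hecke_infty w n f).
Proof.
move=> [[qf f1] [c fS]]; split.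
  by split; [exact: quantum_modular_hecke|exact: hecke_periodic].
pose S : 'M[int]_2 := mx22 0 (-1) 1 0.
have detS : \det S = 1 by rewrite det22 !mx22E; ring.
have denS x : aut_den S x = x by rewrite /aut_den !mx22E mul1r addr0.
have moebS x : moebius S x = - 1 / x.
  by rewrite /moebius denS !mx22E mul0r add0r.
(* Here the cusp value must be the one for which [homext_period_polynomial] holds. *)
have [gam [detgam dengam pE]] := hecke_period w f n_gt0 (f 0 - c ord0) detS.
have [Q sQ QE] : exists2 Q : {poly R[i]}, (size Q <= w.+1)%N &
    forall t, \sum_(i <- hecke_index n)
      (homext w f (f 0 - c ord0) (act (hnf n i) (t, 1)) -
       homext w f (f 0 - c ord0) (act (gam i) (act (hnf n i) (t, 1))))
      = Q.[ratr t].
  (* Induction over sublists of [hecke_index n], keeping the membership that [detgam] needs. *)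
  have : {subset hecke_index n <= hecke_index n} by [].
  elim: {1 3}(hecke_index n) => [|i s IH] sI.
    by exists 0 => [|t]; rewrite ?size_poly0 // big_nil horner0.
  have [Q sQ QE] := IH (fun j js => sI j (mem_behead (s := i :: s) js)).
  have iI : i \in hecke_index n by apply: sI; rewrite mem_head.
  have := polynomial_on_lines_act (hnf n i)
    (homext_period_polynomial w_gt0 w_even f1 fS (detgam i iI)).
  (* These parameters describe the line of points [(t, 1)]. *)
  move=> /(_ 0 1 1 0) [Q' sQ' QE'].
  exists (Q' + Q) => [|t].
    by apply: leq_trans (size_polyD _ _) _; rewrite geq_max sQ'.
  by rewrite big_cons QE hornerD -QE' !mul0r !mul1r add0r addr0.
exists (fun j => Q`_j) => x x0; rewrite -horner_coef_wide // -QE -pE ?denS //.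
by rewrite /period_fun denS moebS.
Qed.
End HeckePolynomialPeriod.

Theorem theorem4p1 (R : realType) (w n : nat) (w_gt0 : (0 < w)%N)
    (w_even : ~~ odd w) (n_gt0 : (0 < n)%N) :
  [/\ forall f : rat -> R[i],
        quantum_modular w f -> quantum_modular w (hecke_infty w n f),
      [set hecke_infty w n f | f in @quantum_modular_p R w]
        `<=` @quantum_modular_p R w &
      [set hecke_infty w n f | f in @quantum_modular_poly_p R w]
        `<=` @quantum_modular_poly_p R w].
Proof.
split.
- by move=> f; exact: quantum_modular_hecke.
- move=> _ [f [qf f1] <-].
  by split; [exact: quantum_modular_hecke|exact: hecke_periodic].
- by move=> _ [f qf <-]; exact: quantum_modular_poly_p_hecke.
Qed.
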